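(* For every spherically convex set $\Omega\subset S^2$, $$\alpha(\Omega)=\pi|\Omega|-\langle c(\Omega),c(\Omega^{*})\rangle ,$$ where $c(\Omega)=\int_{\Omega}u\,du$ and $c(\Omega^{*})=\int_{\Omega^{*}}u\,du$.
   Context: $S^2\subset\mathbb{R}^3$ is the unit sphere, $du,dv$ denote its surface (Lebesgue) measure and $|\Omega|$ is the surface measure of $\Omega$. A spherically convex set is here a nonempty closed set $\Omega\subset S^2$ such that the cone $\{tu:t\ge0,u\in\Omega\}$ is convex and contains no line (as is the case for the visual solid angle of a compact convex set from an exterior point). Let $\tilde\Omega=\{v\in S^2: v^{\perp}\cap\Omega\ne\emptyset\}$, where $v^\perp$ is the plane through the origin orthogonal to $v$. The dual solid cone is $\Omega^{*}=\{v\in S^2:\langle v,u\rangle>0\text{ for all }u\in\Omega\}$, i.e. the component of $S^2\setminus\tilde\Omega$ on which $\langle v,u\rangle>0$ for $u\in\Omega$. The set function $\alpha$ is $$\alpha(\Omega)=\frac12\int_{u\in\Omega,\ v\in\tilde\Omega}|\langle u,v\rangle|\,du\,dv .$$ *)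

(* Defs.v *)
From HB Require Import structures.
From mathcomp Require Import all_boot all_order all_algebra.
From mathcomp Require Import all_classical all_reals all_analysis.
From mathcomp Require Import measurable_realfun.

Set Implicit Arguments.
Unset Strict Implicit.
Unset Printing Implicit Defensive.
Import Order.TTheory GRing.Theory Num.Theory numFieldNormedType.Exports.

Local Open Scope classical_set_scope.
Local Open Scope ring_scope.

(* R^3 with its product topology, vector space structure and sigma-algebra.
   The library norm on a product is the sup norm, hence [dot] and [enorm]. *)
Notation space3 R :=
  (measurableTypeR R * measurableTypeR R * measurableTypeR R)%type.

Section surface_measure.
Context {R : realType}.
Implicit Types (u v x : space3 R) (A : set (space3 R)).

Definition dot u v : R :=
  (u.1.1 : R) * v.1.1 + (u.1.2 : R) * v.1.2 + (u.2 : R) * v.2.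

Definition enorm x : R := Num.sqrt (dot x x).

Definition sphere2 : set (space3 R) := [set u | enorm u = 1].

Definition lebesgue3 : set (space3 R) -> \bar R :=
  ((@lebesgue_measure R \x @lebesgue_measure R) \x @lebesgue_measure R)%E.

HB.instance Definition _ := Measure.on lebesgue3.

Definition punctured_ball : set (space3 R) := [set x | 0 < enorm x <= 1].

Definition radial x : space3 R := (enorm x)^-1 *: x.

(* The surface measure of S^2, seen as a measure on R^3 carried by S^2. It is
   given by polar coordinates: since dx = r^2 dr du, the solid sector
   {x | 0 < |x| <= 1, x / |x| \in A} has volume |A| / 3. *)
Definition surface A : \bar R :=
  (3%:E * lebesgue3 (punctured_ball `&` radial @^-1` A))%E.

Let measurable_x1 : measurable_fun setT (fun x : space3 R => x.1.1 : R).
Proof. exact: (measurableT_comp measurable_fst measurable_fst). Qed.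

Let measurable_x2 : measurable_fun setT (fun x : space3 R => x.1.2 : R).
Proof. exact: (measurableT_comp measurable_snd measurable_fst). Qed.

Let measurable_x3 : measurable_fun setT (fun x : space3 R => x.2 : R).
Proof. exact: measurable_snd. Qed.

Let measurable_dot : measurable_fun setT (fun x : space3 R => dot x x).
Proof.
by apply: measurable_funD; [apply: measurable_funD|]; apply: measurable_funM.
Qed.

Let dot_ge0 x : 0 <= dot x x.
Proof. by rewrite /dot !addr_ge0// -expr2 sqr_ge0. Qed.

Lemma measurable_enorm : measurable_fun setT enorm.
Proof.
rewrite (_ : enorm = fun x => dot x x `^ 2^-1).
  exact: (measurableT_comp (measurable_powR _) measurable_dot).
by apply/funext => x; rewrite powR12_sqrt.
Qed.

Let measurable_invnorm : measurable_fun setT (fun x => (enorm x)^-1).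
Proof.
rewrite (_ : (fun x => _) = fun x => enorm x `^ (-1)).
  exact: (measurableT_comp (measurable_powR _) measurable_enorm).
by apply/funext => x; rewrite powR_inv1// sqrtr_ge0.
Qed.

Lemma measurable_punctured_ball : measurable punctured_ball.
Proof.
rewrite (_ : punctured_ball = setT `&` enorm @^-1` `]0, 1]%classic).
  exact: measurable_enorm.
by rewrite setTI; apply/seteqP; split => x /=; rewrite in_itv.
Qed.

Lemma measurable_radial : measurable_fun setT radial.
Proof.
apply: measurable_fun_pair; first apply: measurable_fun_pair;
  exact: measurable_funM.
Qed.

Let measurable_sector A : measurable A ->
  measurable (punctured_ball `&` radial @^-1` A).
Proof.
move=> mA; apply: measurableI; first exact: measurable_punctured_ball.
by rewrite -[X in measurable X]setTI; exact: measurable_radial.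
Qed.

Let surface0 : surface set0 = 0%E.
Proof. by rewrite /surface preimage_set0 setI0 measure0 mule0. Qed.

Let surface_ge0 A : (0 <= surface A)%E.
Proof. by rewrite /surface mule_ge0. Qed.

Let surface_sigma_additive : semi_sigma_additive surface.
Proof.
move=> F mF tF mUF; rewrite /surface preimage_bigcup setI_bigcupr.
under eq_fun do rewrite -ge0_sume_distrr//.
apply: cvgeZl => //; apply: measure_semi_sigma_additive.
- by move=> n; exact: measurable_sector.
- apply/trivIsetP => i j _ _ ij.
  move/trivIsetP : tF => /(_ i j I I ij) Fij.
  by rewrite setIACA -(preimage_setI radial) Fij preimage_set0 setI0.
- by rewrite -setI_bigcupr -preimage_bigcup; exact: measurable_sector.
Qed.

HB.instance Definition _ := isMeasure.Build _ _ _ surface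
  surface0 surface_ge0 surface_sigma_additive.

Let punctured_ball_cube :
  punctured_ball `<=` (`[-1, 1]%classic `*` `[-1, 1]%classic) `*` `[-1, 1]%classic.
Proof.
move=> [[a b] c]; rewrite /punctured_ball /enorm /dot /= => /andP[_].
rewrite -{1}[1]sqrtr1 ler_sqrt// -!expr2 => h.
have [a0 b0 c0] := And3 (sqr_ge0 (a : R)) (sqr_ge0 (b : R)) (sqr_ge0 (c : R)).
have cube (y : R) : y ^+ 2 <= 1 -> y \in `[-1, 1].
  by move=> y1; rewrite in_itv/= -ler_norml -(@ler_pXn2r _ 2)// ?nnegrE//
    real_normK ?num_real// expr1n.
split; [split|]; apply: cube; apply: le_trans h.
- by rewrite -addrA lerDl addr_ge0.
- by rewrite addrAC lerDr addr_ge0.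
- by rewrite lerDr addr_ge0.
Qed.

Let fin_num_surface : fin_num_fun surface.
Proof.
move=> A mA; rewrite ge0_fin_numE// /surface lte_mul_pinfty//.
apply: (@le_lt_trans _ _
  (lebesgue3 ((`[-1, 1]%classic `*` `[-1, 1]%classic) `*` `[-1, 1]%classic))).
  apply: le_measure; rewrite ?inE.
  - exact: measurable_sector.
  - by do 2?apply: measurableX.
  - by apply: subset_trans punctured_ball_cube; exact: subIsetl.
rewrite /lebesgue3 product_measure1E//; last exact: measurableX.
rewrite [X in (X * _)%E]product_measure1E//.
have itvE : @lebesgue_measure R `[-1, 1]%classic = 2%:E.
  by rewrite lebesgue_measure_itv/= lte_fin gtrN// -EFinB opprK.
pose l := @lebesgue_measure R `[-1, 1]%classic.
by change (l * l * l < +oo)%E; rewrite /l itvE -!EFinM ltry.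
Qed.

HB.instance Definition _ :=
  @Measure_isFinite.Build _ _ _ surface fin_num_surface.

End surface_measure.

Section solid_angles.
Context {R : realType}.
Implicit Types (v : space3 R) (C Omega : set (space3 R)).

Definition cone Omega : set (space3 R) :=
  [set x | exists t u, [/\ 0 <= t :> R, Omega u & x = t *: u]].

Definition contains_line C : Prop :=
  exists p d : space3 R, d != 0 /\ forall s : R, C (p + s *: d).

Definition spherically_convex Omega : Prop :=
  [/\ Omega !=set0, closed Omega, Omega `<=` sphere2,
      convex_set (cone Omega) & ~ contains_line (cone Omega)].

Definition orth v : set (space3 R) := [set x | dot v x = 0].

Definition tilde Omega : set (space3 R) :=
  [set v | sphere2 v /\ orth v `&` Omega !=set0].

Definition dual_cone Omega : set (space3 R) :=
  [set v | sphere2 v /\ forall u, Omega u -> 0 < dot v u].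

Definition alpha Omega : \bar R :=
  ((2^-1)%:E *
   \int[surface \x surface]_(p in Omega `*` tilde Omega)
     `|dot p.1 p.2|%:E)%E.

Definition first_moment Omega : space3 R :=
  (\int[surface]_(u in Omega) (u.1.1 : R),
   \int[surface]_(u in Omega) (u.1.2 : R),
   \int[surface]_(u in Omega) (u.2 : R)).

End solid_angles.

(* Main.v *)
From HB Require Import structures.
Require Import Defs.
From mathcomp Require Import all_boot all_order all_algebra.
From mathcomp Require Import all_classical all_reals all_analysis.
From mathcomp Require Import measurable_realfun.
From mathcomp Require Import ring lra.

(** Fix a unit vector u in Omega. The sphere is the disjoint union of
    tilde Omega, of the dual cone Omega' and of - Omega': a unit vector v that
    is orthogonal to no point of Omega has a constant sign on Omega, because
    the cone over Omega is convex and contains no line ([sphere2_split]). The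
    integral of |<u, v>| over the whole sphere is 2 pi ([integral_abs_dot]), and
    over each of Omega' and - Omega' it is <u, c(Omega')>, since <u, v> > 0 on
    Omega'. Hence the integral of |<u, v>| over v in tilde Omega is
    2 pi - 2 <u, c(Omega')> ([integral_tilde]); integrating over u in Omega and
    halving gives the formula.

    The value 2 pi rests on two facts about the surface measure, which is
    defined by the volume of solid sectors. First, it is invariant under
    v |-> - v and under rotations. A plane rotation is a product of three shears, and a shear
    preserves Lebesgue measure by Fubini and translation invariance; rotations
    commute with the radial projection ([preserves_surface]). So u may be taken
    on the third axis. Second, the polar caps {|v_3| >= t} have total area
    4 pi (1 - t) ([surface_zone]), which is computed by cutting the sector into
    horizontal discs. The layer cake formula then gives
    int_0^1 4 pi (1 - t) dt = 2 pi ([integral_abs_height]).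

    Measurability needs that open subsets of R^3 belong to the product
    sigma-algebra, by a countable base of boxes, and that the dual cone of a
    compact set is relatively open in the sphere. *)

Set Implicit Arguments.
Unset Strict Implicit.
Unset Printing Implicit Defensive.
Import Order.TTheory GRing.Theory Num.Theory numFieldNormedType.Exports.

Local Open Scope classical_set_scope.
Local Open Scope ring_scope.

(** * Measure-preserving maps *)

Section measure_preserving.
Local Open Scope ereal_scope.
Context {R : realType}.

Definition preserves d (T : measurableType d) (mu : set T -> \bar R)
    (phi : T -> T) : Prop :=
  measurable_fun setT phi /\
  forall A, measurable A -> mu (phi @^-1` A) = mu A.

Lemma measurable_preimage d d' (T : measurableType d) (T' : measurableType d')
    (f : T -> T') (A : set T') :
  measurable_fun setT f -> measurable A -> measurable (f @^-1` A).
Proof. by move=> mf mA; rewrite -[X in measurable X]setTI; exact: mf. Qed.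

Lemma preserves_comp d (T : measurableType d) (mu : set T -> \bar R)
    (phi psi : T -> T) :
  preserves mu phi -> preserves mu psi -> preserves mu (phi \o psi).
Proof.
move=> [mphi phiE] [mpsi psiE]; split; first exact: measurableT_comp.
move=> A mA; rewrite comp_preimage psiE ?phiE//.
exact: measurable_preimage.
Qed.

Lemma preserves_integral d (T : measurableType d)
    (mu : {measure set T -> \bar R}) (phi : T -> T) (D : set T)
    (f : T -> \bar R) :
  preserves mu phi -> measurable D -> measurable_fun D f ->
  {in D, forall x, 0 <= f x} ->
  \int[mu]_(x in phi @^-1` D) f (phi x) = \int[mu]_(x in D) f x.
Proof.
move=> [mphi phiE] mD mf f0.
rewrite -[LHS](ge0_integral_pushforward mphi)//.
by apply: eq_measure_integral => A mA _; exact: phiE.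
Qed.

Context d1 d2 (T1 : measurableType d1) (T2 : measurableType d2).
Variable m1 : {sigma_finite_measure set T1 -> \bar R}.
Variable m2 : {sigma_finite_measure set T2 -> \bar R}.

Lemma product_measure_swap X : measurable X -> (m1 \x m2) X = (m1 \x^ m2) X.
Proof.
move=> mX; apply: product_measure_unique => //= B C mB mC.
by rewrite product_measure2E.
Qed.

(** By the very definition of the product measure, whose value at A integrates
    the m2-measure of the slices of A; the map acts on each slice by f (x, .). *)
Lemma preserves_fiber2 (f : T1 * T2 -> T2) : measurable_fun setT f ->
  (forall x, preserves m2 (fun y => f (x, y))) ->
  preserves (m1 \x m2) (fun p => (p.1, f p)).
Proof.
move=> mf fE; split; first exact: measurable_fun_pair.
move=> A mA; rewrite /product_measure1; apply: eq_integral => x _ /=.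
rewrite -(proj2 (fE x) (xsection A x)); last exact: measurable_xsection.
by congr (m2 _); apply/seteqP; split => y /=; rewrite /xsection /= !inE.
Qed.

Lemma preserves_fiber1 (f : T1 * T2 -> T1) : measurable_fun setT f ->
  (forall y, preserves m1 (fun x => f (x, y))) ->
  preserves (m1 \x m2) (fun p => (f p, p.2)).
Proof.
move=> mf fE.
have mF : measurable_fun setT (fun p : T1 * T2 => (f p, p.2)).
  exact: measurable_fun_pair.
split => // A mA.
have mFA := measurable_preimage mF mA.
rewrite !product_measure_swap//.
rewrite /product_measure2; apply: eq_integral => y _ /=.
rewrite -(proj2 (fE y) (ysection A y)); last exact: measurable_ysection.
by congr (m1 _); apply/seteqP; split => x /=; rewrite /ysection /= !inE.
Qed.

End measure_preserving.

Ltac measurable_coords :=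
  repeat first [apply: measurable_funD | apply: measurable_funM
    | apply: measurable_funN | exact: measurable_cst | by []].

(** * Rotations preserve Lebesgue measure and the surface measure *)

Section lebesgue_isometries.
Context {R : realType}.
Local Notation mR := (measurableTypeR R).
Local Notation mu := (@lebesgue_measure R).

(** A Borel measure on the line is determined by its values on half-open
    intervals, and the length of an interval is invariant under translation. *)
Lemma preserves_translation (t : R) : preserves mu (fun x : mR => (x + t : R)).
Proof.
have mt : measurable_fun setT (fun x : mR => (x + t : R) : mR).
  exact: measurable_funD.
split => // A mA.
pose ph : {mfun mR >-> mR} := HB.pack (fun x : mR => (x + t : R) : mR)
  (isMeasurableFun.Build _ _ _ _ _ mt).
apply/esym.
apply: (@lebesgue_measure_unique R (pushforward mu ph)) => //= _ [[a b]] _ <-.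
rewrite /pushforward/= (_ : _ @^-1` _ = `](a - t)%R, (b - t)%R]%classic).
  rewrite !lebesgue_measure_itv/= !lte_fin ltrD2r.
  by case: ifPn => // _; rewrite -!EFinB; congr EFin; ring.
by apply/seteqP; split => x /=; rewrite !in_itv/= ltrBlDr lerBrDr.
Qed.

Lemma preserves_opp : preserves mu (fun x : mR => (- x : R)).
Proof. by split => [|A mA]; [exact: oppr_measurable|exact: lebesgue_measureN]. Qed.

Lemma measurable_coord1 : measurable_fun setT (fun p : space3 R => p.1.1 : R).
Proof. exact: (measurableT_comp measurable_fst measurable_fst). Qed.

Lemma measurable_coord2 : measurable_fun setT (fun p : space3 R => p.1.2 : R).
Proof. exact: (measurableT_comp measurable_snd measurable_fst). Qed.

Lemma measurable_coord3 : measurable_fun setT (fun p : space3 R => p.2 : R).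
Proof. exact: measurable_snd. Qed.

Hint Resolve measurable_coord1 measurable_coord2 measurable_coord3 : core.

(** The plane Lebesgue measure under its own name, so that it can carry the
    structure of a sigma-finite measure that the Fubini theorems require. *)
Definition lebesgue2 : set (mR * mR) -> \bar R := (mu \x mu)%E.

HB.instance Definition _ := Measure.on lebesgue2.

Let sigma_finite_lebesgue2 : sigma_finite setT lebesgue2.
Proof.
have /sigma_finiteP[F [TF ndF Foo]] := sigma_finiteT mu.
exists (fun n => F n `*` F n).
  rewrite -setXTT TF predeqE => -[x y]; split => /=.
    move=> [[n _ Fnx] [k _ Fky]]; exists (maxn n k) => //; split => /=.
    - by move: x Fnx; exact/subsetPset/ndF/leq_maxl.
    - by move: y Fky; exact/subsetPset/ndF/leq_maxr.
  by move=> [n _ []/= ? ?]; split; exists n.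
move=> k; have [mF Fk] := Foo k; split; first exact: measurableX.
rewrite /lebesgue2 product_measure1E//.
by rewrite lte_mul_pinfty// ge0_fin_numE.
Qed.

HB.instance Definition _ := Measure_isSigmaFinite.Build _ _ _ lebesgue2
  sigma_finite_lebesgue2.

Lemma lebesgue3E : lebesgue3 = (lebesgue2 \x mu)%E :> (set (space3 R) -> \bar R).
Proof. by []. Qed.

(** A shear translates every line on which the other coordinates are fixed. *)
Lemma preserves_shear12 (a : R) : preserves lebesgue3
  (fun p : space3 R => (((p.1.1 : R) + a * p.1.2, p.1.2), p.2) : space3 R).
Proof.
rewrite lebesgue3E; apply: preserves_fiber1 => [|z /=].
  by apply: measurable_fun_pair => //; measurable_coords.
apply: preserves_fiber1 => [|y /=]; last exact: preserves_translation.
by apply: measurable_funD => //; apply: measurable_funM.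
Qed.

Lemma preserves_shear21 (a : R) : preserves lebesgue3
  (fun p : space3 R => ((p.1.1, (p.1.2 : R) + a * p.1.1), p.2) : space3 R).
Proof.
rewrite lebesgue3E; apply: preserves_fiber1 => [|z /=].
  by apply: measurable_fun_pair => //; measurable_coords.
apply: preserves_fiber2 => [|x /=]; last exact: preserves_translation.
by apply: measurable_funD => //; apply: measurable_funM.
Qed.

Lemma preserves_shear23 (a : R) : preserves lebesgue3
  (fun p : space3 R => ((p.1.1, (p.1.2 : R) + a * p.2), p.2) : space3 R).
Proof.
rewrite lebesgue3E; apply: preserves_fiber1 => [|z /=].
  by apply: measurable_fun_pair => //; measurable_coords.
apply: preserves_fiber2 => [|x /=]; last exact: preserves_translation.
by apply: measurable_funD => //; apply: measurable_funM.
Qed.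

Lemma preserves_shear32 (a : R) : preserves lebesgue3
  (fun p : space3 R => (p.1, (p.2 : R) + a * p.1.2) : space3 R).
Proof.
rewrite lebesgue3E; apply: preserves_fiber2 => [|q /=]; first by measurable_coords.
exact: preserves_translation.
Qed.

Definition rot12 (c s : R) (p : space3 R) : space3 R :=
  ((c * p.1.1 - s * p.1.2, s * p.1.1 + c * p.1.2), p.2).

Definition rot23 (c s : R) (p : space3 R) : space3 R :=
  ((p.1.1, c * p.1.2 - s * p.2), s * p.1.2 + c * p.2).

(** A plane rotation is a product of three shears,
      (c -s; s c) = (1 a; 0 1) (1 0; s 1) (1 a; 0 1)  with  a = (c - 1) / s,
    which needs s <> 0. *)
Lemma preserves_rot12 (c s : R) : c ^+ 2 + s ^+ 2 = 1 -> s != 0 ->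
  preserves lebesgue3 (rot12 c s).
Proof.
move=> cs1 s0; have c2 : c ^+ 2 = 1 - s ^+ 2 by rewrite -cs1 addrK.
pose a : R := (c - 1) / s.
have asE : a * s = c - 1 by rewrite /a mulfVK.
have acE : a * (c + 1) = - s.
  apply: (mulIf s0); rewrite mulrAC asE; ring: c2.
have := preserves_comp (preserves_shear12 a)
  (preserves_comp (preserves_shear21 s) (preserves_shear12 a)).
congr (preserves _ _); apply/funext => -[[x y] z]; rewrite /rot12/=.
have ac : a * c = - s - a by rewrite -acE; ring.
congr (_, _, _); last by ring: asE.
transitivity (x * (1 + a * s) + y * (a + a * (1 + a * s))); first by ring.
by rewrite asE; ring: ac.
Qed.

Lemma preserves_rot23 (c s : R) : c ^+ 2 + s ^+ 2 = 1 -> s != 0 ->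
  preserves lebesgue3 (rot23 c s).
Proof.
move=> cs1 s0; have c2 : c ^+ 2 = 1 - s ^+ 2 by rewrite -cs1 addrK.
pose a : R := (c - 1) / s.
have asE : a * s = c - 1 by rewrite /a mulfVK.
have acE : a * (c + 1) = - s.
  apply: (mulIf s0); rewrite mulrAC asE; ring: c2.
have := preserves_comp (preserves_shear23 a)
  (preserves_comp (preserves_shear32 s) (preserves_shear23 a)).
congr (preserves _ _); apply/funext => -[[x y] z]; rewrite /rot23/=.
have ac : a * c = - s - a by rewrite -acE; ring.
congr (_, _, _); last by ring: asE.
transitivity (y * (1 + a * s) + z * (a + a * (1 + a * s))); first by ring.
by rewrite asE; ring: ac.
Qed.

Lemma preserves_opp3 : preserves lebesgue3 (fun p : space3 R => - p).
Proof.
have p1 : preserves lebesgue3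
    (fun p : space3 R => ((- (p.1.1 : R), p.1.2), p.2) : space3 R).
  rewrite lebesgue3E; apply: preserves_fiber1 => [|z /=].
    by apply: measurable_fun_pair => //; measurable_coords.
  apply: preserves_fiber1 => [|y /=]; last exact: preserves_opp.
  by measurable_coords.
have p2 : preserves lebesgue3
    (fun p : space3 R => ((p.1.1, - (p.1.2 : R)), p.2) : space3 R).
  rewrite lebesgue3E; apply: preserves_fiber1 => [|z /=].
    by apply: measurable_fun_pair => //; measurable_coords.
  apply: preserves_fiber2 => [|y /=]; last exact: preserves_opp.
  by measurable_coords.
have p3 : preserves lebesgue3
    (fun p : space3 R => (p.1, - (p.2 : R)) : space3 R).
  rewrite lebesgue3E; apply: preserves_fiber2 => [|z /=]; first by measurable_coords.
  exact: preserves_opp.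
have := preserves_comp p1 (preserves_comp p2 p3).
by congr (preserves _ _); apply/funext => -[[x y] z].
Qed.

(** A homogeneous norm-preserving map commutes with the radial projection and
    preserves the ball, so the solid sector over the preimage of A is the preimage
    of the solid sector over A. *)
Lemma preserves_surface (T : space3 R -> space3 R) :
  (forall k x, T (k *: x) = k *: T x) -> (forall x, enorm (T x) = enorm x) ->
  preserves lebesgue3 T -> preserves surface T.
Proof.
move=> TZ Tnorm [mT TE]; split => // A mA; rewrite /surface -(TE (_ `&` radial @^-1` A)).
  congr (_ * lebesgue3 _)%E; apply/funext => x.
  by rewrite /setI /preimage /punctured_ball /radial/= Tnorm TZ.
apply: measurableI; first exact: measurable_punctured_ball.
exact: (measurable_preimage measurable_radial).
Qed.

Lemma surface_rot12 (c s : R) : c ^+ 2 + s ^+ 2 = 1 -> s != 0 ->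
  preserves surface (rot12 c s).
Proof.
move=> cs1 s0; have c2 : c ^+ 2 = 1 - s ^+ 2 by rewrite -cs1 addrK.
apply: preserves_surface; last exact: preserves_rot12.
  by move=> k [[x y] z]; congr (_, _, _); rewrite /= /GRing.scale/=; ring.
move=> [[x y] z]; rewrite /enorm /dot/=; congr Num.sqrt; ring: c2.
Qed.

Lemma surface_rot23 (c s : R) : c ^+ 2 + s ^+ 2 = 1 -> s != 0 ->
  preserves surface (rot23 c s).
Proof.
move=> cs1 s0; have c2 : c ^+ 2 = 1 - s ^+ 2 by rewrite -cs1 addrK.
apply: preserves_surface; last exact: preserves_rot23.
  by move=> k [[x y] z]; congr (_, _, _); rewrite /= /GRing.scale/=; ring.
move=> [[x y] z]; rewrite /enorm /dot/=; congr Num.sqrt; ring: c2.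
Qed.

Lemma surface_opp : preserves surface (fun p : space3 R => - p).
Proof.
apply: preserves_surface; last exact: preserves_opp3.
  by move=> k x; rewrite scalerN.
by move=> [[x y] z]; rewrite /enorm /dot/= !mulrNN.
Qed.

End lebesgue_isometries.

(** * Integrals over an interval and the area of a disc *)

Section calculus.
Context {R : realType}.
Local Notation mR := (measurableTypeR R).
Local Notation mu := (@lebesgue_measure R).

Lemma integral_primitive (f F : R -> R) (a b : R) : a <= b ->
  continuous f -> continuous F ->
  (forall x, a < x < b -> is_derive x 1 F (f x)) ->
  (\int[mu]_(x in `[a, b]) (f x)%:E = (F b - F a)%:E)%E.
Proof.
rewrite le_eqVlt => /predU1P[-> _ _ _|ab cf cF dF].
  by rewrite set_itv1 integral_set1 subrr.
rewrite (continuous_FTC2 ab _ (F := F)) ?EFinB//.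
- exact: continuous_subspaceT.
- split; last 2 first.
  + exact/cvg_at_right_filter/cF.
  + exact/cvg_at_left_filter/cF.
  by move=> x; rewrite in_itv/= => /dF [].
- by move=> x; rewrite in_itv/= => /dF dFx; rewrite derive1E derive_val.
Qed.

Lemma ge0_integral_itv_split (h : R -> R) (a b c : R) : a <= b -> b <= c ->
  measurable_fun setT h -> (forall x, 0 <= h x) ->
  (\int[mu]_(x in `[a, c]) (h x)%:E =
   \int[mu]_(x in `[a, b]) (h x)%:E + \int[mu]_(x in `[b, c]) (h x)%:E)%E.
Proof.
move=> ab bc mh h0.
have mEh D : measurable_fun D (EFin \o h).
  by apply/measurable_EFinP; exact: measurable_funTS.
rewrite -(integral_itv_obnd_cbnd (r := b))//.
rewrite -ge0_integral_setU//=.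
- by rewrite -itv_bndbnd_setU// bnd_simp.
- exact: mEh.
- by move=> x _; rewrite lee_fin.
- apply/disj_setPS => x [] /=; rewrite !in_itv/= => /andP[_ xb] /andP[+ _].
  by rewrite ltNge xb.
Qed.

Lemma integral_quadratic (c0 c1 c2 a b : R) : a <= b ->
  (\int[mu]_(x in `[a, b]) (c0 + c1 * x + c2 * x ^+ 2)%:E =
   (c0 * (b - a) + c1 * (b ^+ 2 - a ^+ 2) / 2
      + c2 * (b ^+ 3 - a ^+ 3) / 3)%:E)%E.
Proof.
move=> ab.
pose P : {poly R} := c0 *: 'X + (c1 / 2) *: 'X^2 + (c2 / 3) *: 'X^3.
pose p := deriv P.
have pE x : c0 + c1 * x + c2 * x ^+ 2 = p.[x].
  by rewrite /p /P !poly.derivE !hornerE/=; field.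
under eq_integral do rewrite pE.
apply: etrans.
  apply: (integral_primitive (F := horner P)) => //.
  - exact: continuous_horner.
  - exact: continuous_horner.
by congr EFin; rewrite /P !hornerE/=; field.
Qed.

Definition disc (c : R) : set (mR * mR) := [set q | (q.1 : R) ^+ 2 + q.2 ^+ 2 <= c].

Lemma xsection_disc c (x : mR) : xsection (disc c) x =
  if (x : R) ^+ 2 <= c then
    `[- Num.sqrt (c - x ^+ 2), Num.sqrt (c - x ^+ 2)]%classic else set0.
Proof.
apply/seteqP; split => y /=; rewrite /xsection /= inE /disc /=.
  move=> h; have xc : (x : R) ^+ 2 <= c.
    by apply: le_trans h; rewrite lerDl sqr_ge0.
  rewrite xc /= in_itv/= -ler_norml -sqrtr_sqr ler_wsqrtr//.
  by rewrite lerBrDl.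
case: ifPn => //= xc; rewrite in_itv/= -ler_norml -sqrtr_sqr.
by rewrite ler_sqrt ?subr_ge0// lerBrDl.
Qed.

(** With r^2 = c and s x the half-chord at abscissa x, F is an antiderivative
    of the chord 2 s x. In the usual primitive x s + r^2 asin (x / r) the arc
    sine is replaced by 2 atan (x / (r + s)), which is continuous up to the end
    points x = r and x = - r. *)
Section disc_area.
Variables (c : R).
Hypothesis c0 : 0 < c.
Let r : R := Num.sqrt c.
Let s (x : R) : R := Num.sqrt (c - x ^+ 2).
Let F (x : R) : R := x * s x + c *+ 2 * atan (x / (r + s x)).

Let r0 : 0 < r. Proof. by rewrite sqrtr_gt0. Qed.

Let r2 : r ^+ 2 = c. Proof. by rewrite sqr_sqrtr// ltW. Qed.

Let rs0 x : 0 < r + s x. Proof. by rewrite ltr_wpDr ?sqrtr_ge0. Qed.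

Let continuous_s : continuous s.
Proof.
move=> x; apply: (continuous_comp (f := fun x : R => c - x ^+ 2)); last first.
  exact: sqrt_continuous.
by apply: continuousB; [exact: cst_continuous|exact: exprn_continuous].
Qed.

Let continuous_F : continuous F.
Proof.
move=> x; apply: cvgD.
  by apply: cvgM; [exact: cvg_id|exact: continuous_s].
apply: cvgM; first exact: cvg_cst.
apply: (continuous_comp (f := fun x : R => x / (r + s x))); last first.
  exact: continuous_atan.
apply: cvgM; first exact: cvg_id.
apply: cvgV; first by rewrite gt_eqF.
by apply: cvgD; [exact: cvg_cst|exact: continuous_s].
Qed.

Let derive_F x : - r < x < r -> is_derive x 1 F (s x *+ 2).
Proof.
move=> xr; have cx : 0 < c - x ^+ 2.
  rewrite -r2 subr_gt0 -(real_normK (num_real x)).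
  by rewrite ltr_pXn2r ?nnegrE ?ltr_norml ?(ltW r0).
have s0 : 0 < s x by rewrite sqrtr_gt0.
have s2 : s x ^+ 2 = c - x ^+ 2 by rewrite sqr_sqrtr// ltW.
have x2 : x ^+ 2 = r ^+ 2 - s x ^+ 2 by rewrite s2 r2; ring.
have dc : is_derive x 1 (cst c - @id R ^+ 2) (- (2 * x)).
  by apply: is_derive_eq; rewrite /= /GRing.scale/=; ring.
have ds : is_derive x 1 s (- x / s x).
  apply: (@is_derive_eq _ _ _ (Num.sqrt \o (cst c - @id R ^+ 2)) x 1).
    by apply: is_derive1_comp; exact: is_derive1_sqrt.
  by rewrite -/(s x); field; rewrite gt_eqF.
have dV : is_derive x 1 (fun y => (r + s y)^-1)
    (- (r + s x) ^- 2 * (- x / s x)).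
  apply: is_deriveV; rewrite ?gt_eqF//.
  apply: (@is_derive_eq _ _ _ (cst r + s) x 1).
  by rewrite add0r.
have dq : is_derive x 1 (fun y => y / (r + s y)) (r / (s x * (r + s x))).
  apply: (@is_derive_eq _ _ _ (@id R * (fun y => (r + s y)^-1)) x 1).
  rewrite /GRing.scale/=; field: x2.
  by rewrite !gt_eqF.
have da : is_derive x 1 (atan \o (fun y : R => y / (r + s y)))
    ((r + s x) / (r *+ 2) * (r / (s x * (r + s x)))).
  apply: (@is_derive_eq _ _ _ (atan \o (fun y : R => y / (r + s y))) x 1).
  congr (_ * _); rewrite (_ : 1 + _ = (r *+ 2) / (r + s x)) ?invf_div//.
  by field: x2; rewrite !gt_eqF.
have dF := is_deriveD (is_deriveM (is_derive_id x 1) ds)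
  (is_deriveM (is_derive_cst (c *+ 2) x 1) da).
apply: (is_derive_eq dF).
rewrite /GRing.scale/= -r2; field: x2.
by rewrite !gt_eqF.
Qed.

Lemma integral_half_chord :
  (\int[mu]_(x in `[(- r)%R, r]) (s x *+ 2)%:E = (pi * c)%:E)%E.
Proof.
apply: etrans.
  apply: (integral_primitive _ _ continuous_F derive_F).
    by rewrite ge0_cp ?ltW.
  by move=> x; apply: cvgMn; exact: continuous_s.
have sr : s r = 0 by rewrite /s r2 subrr sqrtr0.
have sNr : s (- r) = 0 by rewrite /s sqrrN r2 subrr sqrtr0.
rewrite /F sr sNr !mulr0 !add0r addr0 mulNr divff ?gt_eqF// atanN atan1.
by congr EFin; field.
Qed.
End disc_area.

Lemma lebesgue2_disc (c : R) : lebesgue2 (disc c) = (pi * Num.max 0 c)%:E.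
Proof.
have [c0|c0|<-] := ltgtP 0 c; last 2 first.
- rewrite mulr0 (_ : disc c = set0) ?measure0//.
  apply/seteqP; split => // q; rewrite /disc /= => h.
  by have := le_lt_trans h c0; rewrite ltNge addr_ge0// sqr_ge0.
- rewrite mulr0 (_ : disc 0 = [set (0 : mR)] `*` [set (0 : mR)]).
    apply: (etrans (product_measure1E _ _ _ _)) => //.
    by rewrite [X in (X * _)%E](lebesgue_measure_set1 0) mul0e.
  apply/seteqP; split => [[x y]|[x y] [/= -> ->]]; rewrite /disc /=; last first.
    by rewrite expr0n addr0.
  move=> h; have : x ^+ 2 + y ^+ 2 == 0 :> R.
    by rewrite eq_le h addr_ge0// sqr_ge0.
  by rewrite paddr_eq0 ?sqr_ge0// !sqrf_eq0 => /andP[/eqP -> /eqP ->].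
rewrite -(integral_half_chord c0) [LHS]/(\int[mu]_x mu (xsection (disc c) x))%E.
rewrite [RHS]integral_mkcond; apply: eq_integral => x _.
rewrite xsection_disc patchE mem_setE in_itv/=.
rewrite -ler_norml -[`|x|]sqrtr_sqr ler_sqrt ?(ltW c0)//.
case: ifPn => [xc|_]; last by rewrite measure0.
rewrite lebesgue_measure_itv/= lte_fin opprK -mulr2n.
case: ifPn => // /negbTE; rewrite -subr_gt0 opprK -mulr2n pmulrn_lgt0//.
move/negbT; rewrite -leNgt => s0; apply/esym; congr EFin.
by apply/eqP; rewrite mulrn_eq0/= eq_le s0 sqrtr_ge0.
Qed.

(** * The zones of the sphere and the mean height *)

(** For t > 0 this set meets the sphere in two opposite polar caps. The bound
    0 < t makes it empty otherwise, so that t can range over the whole line in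
    the layer cake formula. *)
Definition zone (t : R) : set (space3 R) := [set v | 0 < t <= `|(v.2 : R)| ].

(** At height z the solid sector over the zone is the disc
    x^2 + y^2 <= min (1 - z^2, (t^-2 - 1) z^2): the first bound is the ball, the
    second one the cone |z| >= t |p|. The maximum with 0 accounts for
    |z| > 1, where the slice is empty. *)
Lemma ysection_sector_zone (t : R) (z : mR) : 0 < t <= 1 ->
  lebesgue2 (ysection (punctured_ball `&` radial @^-1` zone t) z) =
  (pi * Num.max 0 (Num.min (1 - z ^+ 2) ((t ^- 2 - 1) * z ^+ 2)))%:E.
Proof.
move=> /andP[t0 t1]; rewrite -lebesgue2_disc.
have [->|z0] := eqVneq (z : R) 0.
  rewrite expr0n/= mulr0 subr0 minEle ler10 lebesgue2_disc maxxx mulr0.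
  rewrite (_ : ysection _ _ = set0) ?measure0//.
  apply/seteqP; split => // q; rewrite /ysection /= inE /= => -[_].
  by rewrite /zone /radial /= scaler0 normr0 leNgt => /andP[->].
(* For z <> 0 the origin of R^3 is not on the slice. *)
congr (lebesgue2 _); apply/funext => -[x y].
rewrite /ysection /= in_setE /disc /=; apply/propext.
pose n := enorm (x, y, z).
have n2 : n ^+ 2 = x ^+ 2 + y ^+ 2 + z ^+ 2.
  rewrite /n /enorm /dot/= sqr_sqrtr; first by ring.
  by rewrite -!expr2 !addr_ge0 ?sqr_ge0.
have n0 : 0 < n.
  rewrite lt_neqAle sqrtr_ge0 andbT eq_sym -sqrf_eq0 n2.
  by rewrite paddr_eq0 ?addr_ge0 ?sqr_ge0// sqrf_eq0 (negPf z0) andbF.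
have t20 : 0 < t ^+ 2 by rewrite exprn_gt0.
rewrite /punctured_ball /radial /zone /= -/n n0 t0/=.
have nz : `|n^-1 *: (z : R)| = `|(z : R)| / n.
  by rewrite normrM normfV (gtr0_norm n0) mulrC.
have n1E : (n <= 1) = (x ^+ 2 + y ^+ 2 + z ^+ 2 <= 1).
  by rewrite -n2 -[1 in RHS](expr1n _ 2) ler_pXn2r// nnegrE ltW.
have tE : (t <= `|(z : R)| / n) =
    (x ^+ 2 + y ^+ 2 + z ^+ 2 <= z ^+ 2 / t ^+ 2).
  rewrite ler_pdivlMr// ler_pdivlMr// -n2 mulrC -exprMn.
  by rewrite -[(z : R) ^+ 2]real_normK ?num_real// ler_pXn2r// nnegrE mulr_ge0// ltW.
rewrite nz n1E tE le_min.
rewrite (_ : (x ^+ 2 + y ^+ 2 <= 1 - _) = (x ^+ 2 + y ^+ 2 + z ^+ 2 <= 1)).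
  rewrite (_ : (x ^+ 2 + y ^+ 2 <= (_ - _) * _) =
    (x ^+ 2 + y ^+ 2 + z ^+ 2 <= z ^+ 2 / t ^+ 2)).
    by split => /andP.
  by rewrite mulrBl mul1r -[RHS]lerBrDr [t ^- 2 * _]mulrC.
by rewrite -[RHS]lerBrDr.
Qed.

Lemma measurable_zone t : measurable (zone t).
Proof.
rewrite (_ : zone t = (fun v => 0 < t <= `|(v.2 : R)|) @^-1` [set true])//.
apply: measurable_preimage => //; apply: measurable_and => //.
by apply: measurable_fun_ler => //; exact: measurableT_comp measurable_coord3.
Qed.

Lemma measurable_sector (A : set (space3 R)) : measurable A ->
  measurable (punctured_ball `&` radial @^-1` A).
Proof.
move=> mA; apply: measurableI; first exact: measurable_punctured_ball.
exact: measurable_preimage measurable_radial mA.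
Qed.

(** Archimedes: the area of a zone is proportional to the heights it covers.
    The volume of the sector is the integral of the areas of its slices, which
    the cone bounds for |z| <= t and the ball for t <= |z| <= 1. *)
Lemma surface_zone (t : R) : 0 < t <= 1 ->
  surface (zone t) = (4 * pi * (1 - t))%:E.
Proof.
move=> t01; have /andP[t0 t1] := t01.
have mS := measurable_sector (measurable_zone t).
rewrite /surface lebesgue3E product_measure_swap//.
pose h (z : R) := pi * Num.max 0 (Num.min (1 - z ^+ 2) ((t ^- 2 - 1) * z ^+ 2)).
rewrite [X in (_ * X)%E](_ : _ = \int[mu]_z (h z)%:E)%E; last first.
  by apply: eq_integral => z _; rewrite /= ysection_sector_zone.
have ph0 z : 0 <= h z by rewrite mulr_ge0 ?pi_ge0// le_max lexx.
have mh : measurable_fun setT h.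
  apply: measurable_funM => //; apply: measurable_maxr => //.
  apply: measurable_minr.
    by apply: measurable_funB => //; exact: measurable_funX.
  by apply: measurable_funM => //; exact: measurable_funX.
have hE z : h z = pi * Num.max 0 (Num.min (1 - z ^+ 2) ((t ^- 2 - 1) * z ^+ 2)).
  by [].
have t20 : 0 < t ^+ 2 by rewrite exprn_gt0.
have minE (z : R) : (1 - z ^+ 2 <= (t ^- 2 - 1) * z ^+ 2) = (t <= `|z|).
  rewrite mulrBl mul1r lerD2r mulrC ler_pdivlMr// mul1r.
  by rewrite -[z ^+ 2]real_normK ?num_real// ler_pXn2r// nnegrE ltW.
have sqr1 (z : R) : (0 <= 1 - z ^+ 2) = (`|z| <= 1).
  by rewrite subr_ge0 -[z ^+ 2]real_normK ?num_real// expr_le1.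
have hout (z : R) : t <= `|z| <= 1 -> h z = pi + 0 * z + (- pi) * z ^+ 2.
  move=> /andP[tz z1]; rewrite hE minEle minE tz max_r ?sqr1//; ring.
have hin (z : R) : `|z| <= t -> h z = 0 + 0 * z + (pi * (t ^- 2 - 1)) * z ^+ 2.
  move=> zt; rewrite hE min_r; last first.
    rewrite mulrBl mul1r lerD2r mulrC ler_pdivrMr// mul1r.
    by rewrite -[z ^+ 2]real_normK ?num_real// ler_pXn2r// nnegrE ltW.
  rewrite max_r; first by ring.
  by rewrite mulr_ge0 ?sqr_ge0// subr_ge0 invf_ge1// expr_le1// ltW.
have h0 (z : R) : 1 < `|z| -> h z = 0.
  move=> z1; rewrite hE max_l ?mulr0// ge_min; apply/orP; left.
  by rewrite leNgt; apply/negP => /ltW; rewrite sqr1 leNgt z1.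
have -> : (\int[mu]_z (h z)%:E = \int[mu]_(z in `[(-1)%R, 1%R]) (h z)%:E)%E.
  rewrite [RHS]integral_mkcond; apply: eq_integral => z _.
  rewrite patchE mem_setE in_itv/= -ler_norml; case: ifPn => //.
  by rewrite -ltNge => /h0 ->.
have Ntt : - t <= t by rewrite ge0_cp ?ltW.
have Nt1 : - 1 <= - t by rewrite lerN2.
rewrite (ge0_integral_itv_split (b := - t))//; last exact: le_trans t1.
rewrite (ge0_integral_itv_split (a := - t) (b := t) (c := 1))//.
under [X in (X + _)%E]eq_integral => z.
  rewrite inE/= in_itv/= => /andP[z1 zt].
  rewrite hout; last first.
    have z0 : z <= 0 by rewrite (le_trans zt)// oppr_le0 ltW.
    by rewrite ler0_norm// lerNr zt lerNl.
  over.
under [X in (_ + (X + _))%E]eq_integral => z.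
  rewrite inE/= in_itv/= -ler_norml => zt; rewrite hin//.
  over.
under [X in (_ + (_ + X))%E]eq_integral => z.
  rewrite inE/= in_itv/= => /andP[z1 zt].
  rewrite hout; last by rewrite ger0_norm ?z1// (le_trans (ltW t0)).
  over.
rewrite !integral_quadratic// -!EFinD -EFinM; congr EFin.
by field; rewrite gt_eqF.
Qed.

(** For t <= 0 the set zone t is empty by definition, and for t > 1 it does not
    meet the sphere. *)
Lemma surface_zone0 (t : R) : ~~ (0 < t <= 1) -> surface (zone t) = 0%E.
Proof.
move=> t01; rewrite /surface.
rewrite (_ : _ `&` _ = set0) ?measure0 ?mule0//.
apply/seteqP; split => // -[[x y] z] [/= b]; rewrite /zone /radial/=.
move: b; rewrite /punctured_ball/=; set n := enorm _ => /andP[n0 n1].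
move=> /andP[t0 tz]; apply: (negP t01); rewrite t0 (le_trans tz)//.
rewrite normrM normfV (gtr0_norm n0) mulrC ler_pdivrMr// mul1r.
rewrite -(ger0_norm (ltW n0)) -ler_sqr ?nnegrE// !real_normK ?num_real//.
rewrite /n /enorm /dot/= sqr_sqrtr -!expr2 ?addr_ge0 ?sqr_ge0//.
by rewrite lerDr addr_ge0 ?sqr_ge0.
Qed.

(** Layer cake: both sides measure the region 0 < t <= |v_3| under the graph of
    the height, the integral by its slices at fixed v and
    int_0^1 4 pi (1 - t) dt = 2 pi by its slices at fixed t. *)
Lemma integral_abs_height :
  (\int[surface]_v `|(v.2 : R)|%:E = (2 * pi)%:E :> \bar R)%E.
Proof.
pose P : set (space3 R * mR) := [set p | 0 < (p.2 : R) <= `|(p.1.2 : R)| ].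
have mP : measurable P.
  rewrite (_ : P = (fun p => 0 < (p.2 : R) <= `|(p.1.2 : R)|) @^-1` [set true])//.
  apply: measurable_preimage => //; apply: measurable_and.
    exact: measurable_fun_ltr.
  apply: measurable_fun_ler => //; apply: measurableT_comp => //.
  exact: measurableT_comp measurable_coord3 measurable_fst.
transitivity ((surface \x mu)%E P).
  apply: eq_integral => v _ /=.
  rewrite (_ : xsection P v = `]0, `|(v.2 : R)|]%classic).
    rewrite lebesgue_measure_itv/= lte_fin.
    case: ifPn => [_|]; rewrite ?sube0// -leNgt => v0.
    by congr EFin; apply/eqP; rewrite eq_le normr_ge0 v0.
  by apply/seteqP; split => t /=; rewrite /xsection/= in_setE/= in_itv.
rewrite product_measure_swap//.
transitivity (\int[mu]_(t in `]0%R, 1%R]) (4 * pi + (- (4 * pi)) * t + 0 * t ^+ 2)%:E)%E.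
  rewrite [RHS]integral_mkcond; apply: eq_integral => t _ /=.
  rewrite (_ : ysection P t = zone t).
    rewrite patchE mem_setE in_itv/=; case: ifPn => [t01|]; last exact: surface_zone0.
    by rewrite surface_zone//; congr EFin; ring.
  by apply/seteqP; split => v /=; rewrite /ysection/= in_setE.
rewrite integral_itv_obnd_cbnd.
  by rewrite integral_quadratic//; congr EFin; field.
apply/measurable_EFinP/measurable_funTS.
by do 2?[apply: measurable_funD => //]; apply: measurable_funM => //; exact: measurable_funX.
Qed.

End calculus.

(** * The projections of the sphere *)

Section total_projection.
Context {R : realType}.
Local Notation mR := (measurableTypeR R).

Lemma measurable_fun_dot d (T : measurableType d) (f g : T -> space3 R) :
  measurable_fun setT f -> measurable_fun setT g ->
  measurable_fun setT (fun x => dot (f x) (g x)).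
Proof.
move=> mf mg; apply: measurable_funD; first apply: measurable_funD.
- by apply: measurable_funM; exact: measurableT_comp measurable_coord1 _.
- by apply: measurable_funM; exact: measurableT_comp measurable_coord2 _.
- by apply: measurable_funM; exact: measurableT_comp measurable_coord3 _.
Qed.

Let K (u : space3 R) : \bar R := (\int[surface]_v `|dot u v|%:E)%E.

Let K_preserves (phi : space3 R -> space3 R) (u w : space3 R) :
  preserves surface phi -> (forall v, dot u (phi v) = dot w v) -> K u = K w.
Proof.
move=> phiP uw; rewrite /K -(preserves_integral phiP)//.
- by rewrite preimage_setT; apply: eq_integral => v _; rewrite uw.
- apply/measurable_EFinP/measurableT_comp => //.
  exact: measurable_fun_dot.
Qed.

Let sqr_sqrt_add (a b : R) : Num.sqrt (a ^+ 2 + b ^+ 2) ^+ 2 = a ^+ 2 + b ^+ 2.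
Proof. by rewrite sqr_sqrtr// addr_ge0 ?sqr_ge0. Qed.

Let rotation_coef (a b r : R) : a != 0 -> r ^+ 2 = a ^+ 2 + b ^+ 2 ->
  [/\ r != 0, (b / r) ^+ 2 + (- a / r) ^+ 2 = 1 & - a / r != 0].
Proof.
move=> a0 r2; have r0 : r != 0.
  by rewrite -sqrf_eq0 r2 paddr_eq0 ?sqr_ge0// sqrf_eq0 (negPf a0).
split => //; last by rewrite mulf_neq0 ?oppr_eq0// invr_eq0.
rewrite !expr_div_n sqrrN -mulrDl addrC -r2 divff//.
by rewrite sqrf_eq0.
Qed.

Let K_rot12 (a b z : R) : exists2 b' : R, b' ^+ 2 = a ^+ 2 + b ^+ 2 &
  K (a, b, z) = K (0, b', z).
Proof.
have [->|a0] := eqVneq a 0; first by exists b; rewrite // expr0n add0r.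
pose r := Num.sqrt (a ^+ 2 + b ^+ 2).
have r2 : r ^+ 2 = a ^+ 2 + b ^+ 2 by exact: sqr_sqrt_add.
have [r0 cs1 s0] := rotation_coef a0 r2.
exists r => //; apply: (K_preserves (surface_rot12 cs1 s0)) => -[[x y] w].
rewrite /dot/= (_ : 0 * _ = 0) ?mul0r// add0r; apply: (mulfI r0).
transitivity (y * r ^+ 2 + r * z * w); last by ring.
by rewrite r2; field.
Qed.

Let K_rot23 (b z : R) : exists2 z' : R, z' ^+ 2 = b ^+ 2 + z ^+ 2 &
  K (0, b, z) = K (0, 0, z').
Proof.
have [->|b0] := eqVneq b 0; first by exists z; rewrite // expr0n add0r.
pose r := Num.sqrt (b ^+ 2 + z ^+ 2).
have r2 : r ^+ 2 = b ^+ 2 + z ^+ 2 by exact: sqr_sqrt_add.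
have [r0 cs1 s0] := rotation_coef b0 r2.
exists r => //; apply: (K_preserves (surface_rot23 cs1 s0)) => -[[x y] w].
rewrite /dot/= !mul0r !add0r; apply: (mulfI r0).
transitivity (w * r ^+ 2); last by ring.
by rewrite r2; field.
Qed.

(** Rotating first in the plane of the first two coordinates and then in that
    of the last two moves u onto the third axis, and neither rotation changes
    the integral. *)
Lemma integral_abs_dot (u : space3 R) : sphere2 u ->
  (\int[surface]_v `|dot u v|%:E = (2 * pi)%:E)%E.
Proof.
move: u => [[a b] z] u1; rewrite -[LHS]/(K (a, b, z)).
have [b' b'2 ->] := K_rot12 a b z; have [z' z'2 ->] := K_rot23 b' z.
have : z' ^+ 2 == 1.
  rewrite z'2 b'2; move: u1; rewrite /sphere2/= /enorm /dot/= => u1.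
  by rewrite -[1](expr1n _ 2) -u1 sqr_sqrtr -!expr2// !addr_ge0 ?sqr_ge0.
rewrite sqrf_eq1 => z'1; rewrite -integral_abs_height.
apply: eq_integral => -[[x y] w] _; rewrite /dot/= !mul0r !add0r normrM.
by case/orP: z'1 => /eqP ->; rewrite ?normrN normr1 mul1r.
Qed.

End total_projection.

(** * Open sets of R^3 and the dual cone are measurable *)

Section borel.
Context {R : realType}.
Local Notation mR := (measurableTypeR R).

(** The neighbourhoods are given by an arbitrary function nb, so that the notion
    passes to products without any compatibility between a topology and a
    sigma-algebra on the same type. *)
Definition has_countable_base d (T : measurableType d)
    (nb : T -> set (set T)) : Prop :=
  exists (I : countType) (B : I -> set T), (forall i, measurable (B i)) /\
    forall x U, nb x U -> exists2 i, B i x & B i `<=` U.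

Lemma countable_base_measurable d (T : measurableType d)
    (nb : T -> set (set T)) (U : set T) :
  has_countable_base nb -> (forall x, U x -> nb x U) -> measurable U.
Proof.
move=> [I [B [mB nbB]]] oU.
rewrite (_ : U = \bigcup_i (if `[< B i `<=` U >] then B i else set0)).
  apply: countable_bigcupT_measurable => [|i]; first exact: countableP.
  by case: ifPn.
apply/seteqP; split => [x Ux|x [i _]]; last by case: asboolP => // /(_ x).
have [i Bix BiU] := nbB x U (oU x Ux).
by exists i => //; rewrite asboolT.
Qed.

Lemma countable_base_real : has_countable_base (fun x : mR => nbhs (x : R)).
Proof.
exists (rat * rat)%type, (fun pq => `]ratr pq.1, ratr pq.2[%classic); split => //.
move=> x U /nbhs_ballP[e /= e0 eU].
have [p] : exists p : rat, ratr p \in `](x - e : R), (x : R)[ .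
  by apply: rat_in_itvoo; rewrite ltrBlDr ltrDl.
rewrite in_itv/= => /andP[xp px].
have [q] : exists q : rat, ratr q \in `](x : R), (x + e : R)[ .
  by apply: rat_in_itvoo; rewrite ltrDl.
rewrite in_itv/= => /andP[xq qx].
exists (p, q); first by rewrite /= in_itv/= px.
move=> y /=; rewrite in_itv/= => /andP[py yq]; apply: eU.
rewrite /ball/= ltr_distlC; apply/andP; split; first exact: lt_trans py.
exact: lt_trans qx.
Qed.

Lemma countable_base_prod d1 d2 (T1 : measurableType d1) (T2 : measurableType d2)
    (nb1 : T1 -> set (set T1)) (nb2 : T2 -> set (set T2)) :
  has_countable_base nb1 -> has_countable_base nb2 ->
  has_countable_base (fun p : T1 * T2 => filter_prod (nb1 p.1) (nb2 p.2)).
Proof.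
move=> [I [B [mB nbB]]] [J [C [mC nbC]]].
exists (I * J)%type, (fun ij => B ij.1 `*` C ij.2); split => [ij|p U].
  exact: measurableX.
move=> [[V W] /= [/nbB[i Bi BiV] /nbC[j Cj CjW]] VWU].
exists (i, j) => //= q [Bq Cq]; apply: VWU; split; [exact: BiV|exact: CjW].
Qed.

Lemma open_measurable3 (U : set (space3 R)) : open U -> measurable U.
Proof.
rewrite openE => oU.
apply: (countable_base_measurable (countable_base_prod
  (countable_base_prod countable_base_real countable_base_real)
  countable_base_real)) => x Ux.
exact: oU.
Qed.

Lemma closed_measurable3 (U : set (space3 R)) : closed U -> measurable U.
Proof.
move=> cU; rewrite -(setCK U); apply: measurableC; apply: open_measurable3.
exact: closed_openC.
Qed.

Lemma measurable_sphere2 : measurable (@sphere2 R).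
Proof.
rewrite (_ : sphere2 = enorm @^-1` [set (1 : mR)])//.
exact: measurable_preimage (@measurable_enorm R) _.
Qed.

Lemma sphere2_cube (v : space3 R) : sphere2 v ->
  [/\ `|(v.1.1 : R)| <= 1, `|(v.1.2 : R)| <= 1 & `|(v.2 : R)| <= 1].
Proof.
move: v => [[x y] z]; rewrite /sphere2/= => v1.
have := congr1 (fun t : R => t ^+ 2) v1.
rewrite /enorm /dot /= sqr_sqrtr -?expr2 ?addr_ge0 ?sqr_ge0// expr1n => s1.
have le1 (t : R) : t ^+ 2 <= 1 -> `|t| <= 1.
  by rewrite -[t ^+ 2]real_normK ?num_real// expr_le1.
have := (sqr_ge0 (x : R), sqr_ge0 (y : R), sqr_ge0 (z : R)) => -[[x0 y0] z0].
by split; apply: le1; rewrite -s1; lra.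
Qed.

Lemma compact_sphere2_closed (A : set (space3 R)) :
  closed A -> A `<=` sphere2 -> compact A.
Proof.
move=> cA As; apply: (subclosed_compact cA
  (compact_setX (compact_setX (@segment_compact R (-1) 1)
    (@segment_compact R (-1) 1)) (@segment_compact R (-1) 1))).
by move=> v /As /sphere2_cube[? ? ?]; split; [split|]; rewrite /= in_itv/= -ler_norml.
Qed.

Lemma cvg_dot (u v : space3 R) :
  dot p.2 p.1 @[p --> (nbhs u, nbhs v)] --> (dot v u : R).
Proof.
have c1 (x : space3 R) : (p.1.1 : R) @[p --> x] --> (x.1.1 : R).
  exact: (cvg_comp _ _ cvg_fst cvg_fst).
have c2 (x : space3 R) : (p.1.2 : R) @[p --> x] --> (x.1.2 : R).
  exact: (cvg_comp _ _ cvg_fst cvg_snd).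
have c3 (x : space3 R) : (p.2 : R) @[p --> x] --> (x.2 : R) by exact: cvg_snd.
by apply: cvgD; [apply: cvgD|]; apply: cvgM;
  try exact: (cvg_comp _ _ cvg_fst (c1 u));
  try exact: (cvg_comp _ _ cvg_fst (c2 u));
  try exact: (cvg_comp _ _ cvg_fst (c3 u));
  try exact: (cvg_comp _ _ cvg_snd (c1 v));
  try exact: (cvg_comp _ _ cvg_snd (c2 v));
  exact: (cvg_comp _ _ cvg_snd (c3 v)).
Qed.

(** By compactness, the strict inequalities 0 < dot v u for all u in A persist
    for v' near v: the dual cone is an open subset of the sphere. *)
Lemma measurable_dual_cone (A : set (space3 R)) :
  compact A -> measurable (dual_cone A).
Proof.
move=> cA.
rewrite (_ : dual_cone A = sphere2 `&` [set v | A `<=` [set u | 0 < dot v u]])//.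
apply: measurableI; first exact: measurable_sphere2.
apply: open_measurable3; rewrite openE => v Av.
have cov := proj1 (compact_near_coveringP A) cA (space3 R) (nbhs v)
  (fun w u => 0 < dot w u) _ _.
apply: cov => u Au.
exact: (cvgr_gt _ (@cvg_dot u v) _ (Av u Au)).
Qed.

End borel.

(** * The component of the complement of tilde Omega *)

Section spherical_convexity.
Context {R : realType}.
Implicit Types (u v x : space3 R) (Omega D : set (space3 R)).

Lemma dotC u v : dot u v = dot v u.
Proof. by rewrite /dot; ring. Qed.

Lemma dotDr u v x : dot u (v + x) = dot u v + dot u x.
Proof. by rewrite /dot/=; ring. Qed.

Lemma dotZr (k : R) u v : dot u (k *: v) = k * dot u v.
Proof. by rewrite /dot/= /GRing.scale/=; ring. Qed.

Lemma dotNr u v : dot u (- v) = - dot u v.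
Proof. by rewrite /dot/=; ring. Qed.

Lemma sphere2_neq0 u : sphere2 u -> u != 0.
Proof.
move=> u1; apply/eqP => u0; move: u1; rewrite u0 /sphere2 /enorm /dot/=.
by rewrite !mulr0 !addr0 sqrtr0 => /esym/eqP; rewrite oner_eq0.
Qed.

Lemma sphere2N v : sphere2 (- v) = sphere2 v.
Proof. by rewrite /sphere2 /enorm/= dotNr dotC dotNr opprK. Qed.

(** The point of the segment from u1 to u2 that is orthogonal to v lies in the
    cone. It is not the origin, as otherwise u2 would be a negative multiple of
    u1 and the cone would contain the line through them; so it is a positive
    multiple of a point of Omega. *)
Lemma spherically_convex_sign Omega v u1 u2 : spherically_convex Omega ->
  Omega u1 -> Omega u2 -> 0 < dot v u1 -> dot v u2 < 0 ->
  exists2 u, Omega u & dot v u = 0.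
Proof.
move=> [_ _ Osph cvx noline] O1 O2 p0; rewrite -oppr_gt0.
set p := dot v u1 in p0 *; set q := - dot v u2 => q0.
have pq0 : 0 < p + q by rewrite addr_gt0.
have l0 : 0 <= q / (p + q) by rewrite divr_ge0// ltW.
have l1 : q / (p + q) <= 1 by rewrite ler_pdivrMr// mul1r lerDr ltW.
have inO u : Omega u -> u \in cone Omega.
  by move=> Ou; rewrite inE; exists 1, u; rewrite scale1r; split.
pose l := Itv01 l0 l1.
have := cvx u1 u2 l (inO _ O1) (inO _ O2).
rewrite inE => -[t [u [t0 Ou wE]]].
have {}wE : (q / (p + q)) *: u1 + (1 - q / (p + q)) *: u2 = t *: u by [].
exists u => //.
have : t * dot v u = 0.
  rewrite -dotZr -wE dotDr !dotZr -/p -[dot v u2]opprK -/q.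
  by field; rewrite gt_eqF.
move/eqP; rewrite mulf_eq0 => /orP[/eqP t00|/eqP//].
exfalso; apply: noline; exists 0, u1; split; first exact/sphere2_neq0/Osph.
have u2E : - u1 = (p / q) *: u2.
  move: wE; rewrite t00 scale0r => /eqP; rewrite addr_eq0 => /eqP wE.
  have {}wE : (1 - q / (p + q)) *: u2 = - ((q / (p + q)) *: u1).
    by rewrite wE opprK.
  rewrite (_ : p / q = ((p + q) / q) * (1 - q / (p + q))); last first.
    by field; rewrite !gt_eqF.
  rewrite -scalerA wE scalerN scalerA (_ : _ * _ = 1) ?scale1r//.
  by field; rewrite !gt_eqF.
move=> s; rewrite add0r; have [s0|s0] := leP 0 s; first by exists s, u1.
exists (- s * (p / q)), u2; split => //.
  by apply: mulr_ge0; rewrite ?oppr_ge0 ?divr_ge0 ?ltW.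
by rewrite -scalerA -u2E scalerN scaleNr opprK.
Qed.

(** A vector v that is orthogonal to no point of Omega has a constant sign on
    Omega, hence v or - v is in the dual cone. *)
Lemma sphere2_split Omega : spherically_convex Omega ->
  tilde Omega = sphere2 `\` (dual_cone Omega `|` -%R @^-1` dual_cone Omega).
Proof.
move=> cO; have [[u0 Ou0] _ _ _ _] := cO.
apply/seteqP; split => [v [v1 [u [vu Ou]]]|v [v1 vD]]; rewrite /tilde/=.
  split => // -[] [_ /(_ u Ou)]; rewrite dotC ?dotNr dotC vu ?oppr0 ltxx //.
split => //; apply: contrapT => noorth.
have vn0 u : Omega u -> dot v u != 0.
  by move=> Ou; apply/eqP => vu; apply: noorth; exists u.
apply: vD; have [v0|v0] := ltP 0 (dot v u0).
  left; split => // u Ou; rewrite ltNge; apply/negP => vu.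
  have vu' : dot v u < 0 by rewrite lt_neqAle vn0.
  have [w Ow vw] := spherically_convex_sign cO Ou0 Ou v0 vu'.
  by have := vn0 _ Ow; rewrite vw eqxx.
right; split; first by rewrite sphere2N.
move=> u Ou; rewrite dotC dotNr dotC oppr_gt0 ltNge; apply/negP => vu.
have vu' : 0 < dot v u by rewrite lt_neqAle eq_sym vn0.
have v0' : dot v u0 < 0 by rewrite lt_neqAle vn0.
have [w Ow vw] := spherically_convex_sign cO Ou Ou0 vu' v0'.
by have := vn0 _ Ow; rewrite vw eqxx.
Qed.

End spherical_convexity.

(** * Integrals over the sphere *)

Section projection_integrals.
Context {R : realType}.
Implicit Types (u v x : space3 R) (Omega D : set (space3 R)).

Lemma surface_sphere2C : surface (~` @sphere2 R) = 0%E.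
Proof.
rewrite /surface (_ : _ `&` _ = set0) ?measure0 ?mule0//.
apply/seteqP; split => // x [/andP[n0 _]]; apply.
rewrite /sphere2/= /radial {1}/enorm dotZr dotC dotZr mulrA -expr2.
have x2 : dot x x = enorm x ^+ 2.
  rewrite /enorm sqr_sqrtr// /dot -!expr2 !addr_ge0 ?sqr_ge0//.
by rewrite x2 -exprMn mulVf ?gt_eqF// expr1n sqrtr1.
Qed.

Lemma integrable_bounded (f : space3 R -> R) D : measurable D ->
  measurable_fun setT f -> (forall v, D v -> `|f v| <= 1) ->
  surface.-integrable D (EFin \o f).
Proof.
move=> mD mf f1; apply: measurable_bounded_integrable => //.
- by rewrite ltey_eq fin_num_measure.
- exact: measurable_funTS.
- by exists 1; split => // M M1 v Dv; exact: le_trans (f1 v Dv) (ltW M1).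
Qed.

Lemma integrable_coord D : measurable D -> D `<=` sphere2 ->
  [/\ surface.-integrable D (fun v => (v.1.1 : R)%:E),
      surface.-integrable D (fun v => (v.1.2 : R)%:E) &
      surface.-integrable D (fun v => (v.2 : R)%:E)].
Proof.
move=> mD Ds; split.
- apply: (integrable_bounded (f := fun v => v.1.1)) => //.
    exact: measurable_coord1.
  by move=> v /Ds /sphere2_cube [].
- apply: (integrable_bounded (f := fun v => v.1.2)) => //.
    exact: measurable_coord2.
  by move=> v /Ds /sphere2_cube [].
- apply: (integrable_bounded (f := fun v => v.2)) => //.
    exact: measurable_coord3.
  by move=> v /Ds /sphere2_cube [].
Qed.

Lemma integral_dot D u : measurable D -> D `<=` sphere2 ->
  surface.-integrable D (fun v => (dot u v)%:E) /\
  (\int[surface]_(v in D) (dot u v)%:E = (dot u (first_moment D))%:E)%E.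
Proof.
move=> mD Ds; have [i1 i2 i3] := integrable_coord mD Ds.
have j1 := integrableZl mD u.1.1 i1.
have j2 := integrableZl mD u.1.2 i2.
have j3 := integrableZl mD u.2 i3.
have j12 := integrableD mD j1 j2.
split; first exact: (integrableD mD j12 j3).
rewrite [LHS](integralD mD j12 j3) (integralD mD j1 j2) !integralZl//.
by rewrite /dot /first_moment /Rintegral/= !EFinD !EFinM !fineK// integrable_fin_num.
Qed.

Lemma measurable_dual Omega : spherically_convex Omega ->
  measurable (dual_cone Omega) /\ measurable (-%R @^-1` dual_cone Omega).
Proof.
move=> [_ clO Os _ _].
have mD : measurable (dual_cone Omega).
  by apply: measurable_dual_cone; exact: compact_sphere2_closed.
split => //; have [mN _] := @surface_opp R; exact: measurable_preimage.
Qed.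

Lemma measurable_tilde Omega : spherically_convex Omega ->
  measurable (tilde Omega).
Proof.
move=> cO; have [mD mND] := measurable_dual cO.
rewrite (sphere2_split cO); apply: measurableD.
  exact: measurable_sphere2.
exact: measurableU.
Qed.

(** The sphere is the disjoint union of tilde Omega, the dual cone and its
    opposite. On each of the last two |dot u v| integrates to the inner product
    of u with the first moment of the dual cone. *)
Lemma integral_tilde Omega u : spherically_convex Omega -> Omega u ->
  (\int[surface]_(v in tilde Omega) `|dot u v|%:E =
   (2 * pi - 2 * dot u (first_moment (dual_cone Omega)))%:E)%E.
Proof.
move=> cO Ou; have [_ clO Os _ _] := cO.
set D := dual_cone Omega.
have [mD mND] := measurable_dual cO.
have ms := @measurable_sphere2 R.
have mt := measurable_tilde cO.
have mdot A : measurable_fun A (fun v => `|dot u v|%:E).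
  apply/measurable_funTS/measurable_EFinP/measurableT_comp => //.
  exact: measurable_fun_dot.
have Ds : D `<=` sphere2 by move=> v [].
have [iD ED] := integral_dot u mD Ds.
have intD : (\int[surface]_(v in D) `|dot u v|%:E =
    (dot u (first_moment D))%:E)%E.
  rewrite -ED; apply: eq_integral => v; rewrite inE => -[_ /(_ u Ou)].
  by rewrite dotC => /gtr0_norm ->.
have intND : (\int[surface]_(v in -%R @^-1` D) `|dot u v|%:E =
    (dot u (first_moment D))%:E)%E.
  rewrite -intD -(preserves_integral (D := D) (@surface_opp R))//.
  by apply: eq_integral => v _; rewrite dotNr normrN.
have := integral_abs_dot (Os u Ou).
have -> : [set: space3 R] = tilde Omega `|` (D `|` (-%R @^-1` D `|` ~` sphere2)).
  apply/seteqP; split => // v _; rewrite (sphere2_split cO) -/D.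
  have [vs|vs] := pselect (sphere2 v); last by right; right; right.
  have [vD|vD] := pselect ((D `|` -%R @^-1` D) v); last by left.
  by right; case: vD; [left|right; left].
rewrite ge0_integral_setU//; last 2 first.
  by do 2?apply: measurableU => //; exact: measurableC.
  apply/disj_setPS => v []; rewrite (sphere2_split cO) => -[vs nD] vC.
  by apply: nD; case: vC => [vD|[vD|/(_ vs)//]]; [left|right].
rewrite ge0_integral_setU//; last 2 first.
  by apply: measurableU => //; exact: measurableC.
  apply/disj_setPS => v [[vs /(_ u Ou) vu]] [[_ /(_ u Ou)]|//].
  by rewrite dotC dotNr dotC oppr_gt0 ltNge (ltW vu).
rewrite ge0_integral_setU//; last 2 first.
  exact: measurableC.
  by apply/disj_setPS => v [[+ _]]; rewrite sphere2N.
rewrite intD intND (null_set_integral (N := ~` sphere2))//; last 2 first.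
  exact: measurableC.
  exact: surface_sphere2C.
rewrite adde0 -EFinD => /eqP; rewrite eq_sym -sube_eq ?fin_num_adde_defl//.
move=> /eqP <-; rewrite -EFinB; congr EFin; ring.
Qed.

End projection_integrals.

(** * The formula for alpha *)

Local Open Scope ereal_scope.

Theorem mainTheorem6 (R : realType) (Omega : set (space3 R))
    (hOmega : spherically_convex Omega) :
  alpha Omega =
  pi%:E * surface Omega
    - (dot (first_moment Omega) (first_moment (dual_cone Omega)))%:E.
Proof.
have cO := hOmega; have [_ clO Os _ _] := cO.
set c := first_moment (dual_cone Omega).
have mO : measurable Omega by exact: closed_measurable3.
have mt := measurable_tilde cO.
have mf A : measurable_fun A (fun p : space3 R * space3 R => `|dot p.1 p.2|%:E).
  apply/measurable_funTS/measurable_EFinP/measurableT_comp => //.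
  exact: measurable_fun_dot.
(* Tonelli: for fixed u in Omega the inner integral is the one over tilde Omega. *)
have -> : alpha Omega = ((2^-1)%:E *
    \int[surface]_(u in Omega) (2 * pi - 2 * dot c u)%:E)%E.
  rewrite /alpha; congr (_ * _)%E.
  rewrite integral_mkcond fubini_tonelli1; last 2 first.
  - exact: (proj1 (measurable_restrictT _ (measurableX mO mt))).
  - by move=> p; rewrite patchE; case: ifPn.
  rewrite [RHS]integral_mkcond; apply: eq_integral => u _.
  rewrite /fubini_F patchE; case: ifPn => [|uO].
    rewrite inE => Ou; rewrite dotC -integral_tilde// [RHS]integral_mkcond.
    apply: eq_integral => v _; rewrite !patchE in_setX/= mem_set//.
  rewrite integral0_eq// => v _; rewrite patchE in_setX/= (negPf uO)//.
have [iO EO] := integral_dot c mO Os.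
have fO : surface Omega \is a fin_num by exact: fin_num_measure.
have i2 := integrableZl mO 2 iO.
have ic := finite_measure_integrable_cst surface (2 * pi) mO.
have -> : (\int[surface]_(u in Omega) (2 * pi - 2 * dot c u)%:E =
    (2 * pi)%:E * surface Omega - 2%:E * (dot c (first_moment Omega))%:E)%E.
  rewrite [LHS](integralB mO ic i2) integralZl// EO; congr (_ - _)%E.
  exact: (integral_cst surface mO (2 * pi)%:E).
rewrite -(fineK fO) dotC -!(EFinM, EFinB). congr EFin.
by field.
Qed.
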